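(* The almost local equivalence group $\widehat{\mathfrak I}$, with its partial order $\leq$, is totally ordered: for any two elements $X,Y\in\widehat{\mathfrak I}$, either $X\leq Y$ or $Y\leq X$.
   Context: $\mathbb F$ is the field with two elements and $\mathbb F[U]$ is graded with $\deg U=-2$. Chain complexes over $\mathbb F[U]$ have $U$-equivariant differential $\partial$ of degree $-1$. For $\mathbb F[U]$-module maps, ''$f\in\operatorname{im}U$'' means that the image of $f$ is contained in $U\cdot(\text{target})$, and $f\equiv g \bmod U$ means $f+g\in\operatorname{im}U$. Two grading-preserving $\mathbb F[U]$-module homomorphisms $f,g\colon C_1\to C_2$ between free, finitely generated, $\mathbb Z$-graded chain complexes over $\mathbb F[U]$ are homotopic mod $U$, written $f\simeq g \bmod U$, if there is an $\mathbb F[U]$-module homomorphism $H\colon C_1\to C_2$ raising grading by one with $f+g+H\partial+\partial H\in\operatorname{im}U$. An almost $\iota$-complex $\mathcal C=(C,\overline\iota)$ consists of a free, finitely generated, $\mathbb Z$-graded chain complex $C$ over $\mathbb F[U]$ with $U^{-1}H_*(C)\cong\mathbb F[U,U^{-1}]$ supported in even gradings, and a grading-preserving $\mathbb F[U]$-module homomorphism $\overline\iota\colon C\to C$ with $\overline\iota\partial+\partial\overline\iota\in\operatorname{im}U$ and $\overline\iota^2\simeq\mathrm{id}\bmod U$. By convention, gradings are normalized so that the maximal grading of a $U$-nontorsion homogeneous element of $H_*(C)$ is $0$. An almost $\iota$-morphism $(C_1,\overline\iota_1)\to(C_2,\overline\iota_2)$ is a grading-preserving, $U$-equivariant chain map $f$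 with $f\overline\iota_1\simeq\overline\iota_2 f\bmod U$; it is a local map if it induces an isomorphism on $U^{-1}H_*$. Two almost $\iota$-complexes are locally equivalent if there are local maps between them in both directions. $\widehat{\mathfrak I}$ is the abelian group of almost $\iota$-complexes modulo local equivalence, with operation $(C_1,\overline\iota_1)\otimes(C_2,\overline\iota_2)=(C_1\otimes_{\mathbb F[U]}C_2,\overline\iota_1\otimes\overline\iota_2)$, identity $\mathcal C(0)=(\mathbb F[U],\mathrm{id})$ (generator in grading $0$), and inverses given by dualizing over $\mathbb F[U]$. The partial order is: $\mathcal C_1\leq\mathcal C_2$ if and only if there is a local map $\mathcal C_1\to\mathcal C_2$; it is compatible with the group structure. *)

(* Defs.v *)
From HB Require Import structures.
From mathcomp Require Import all_boot all_order all_algebra.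
From mathcomp Require Import boolp zify ring.

Set Implicit Arguments.
Unset Strict Implicit.
Unset Printing Implicit Defensive.

Import Order.TTheory GRing.Theory Num.Theory.

Local Open Scope ring_scope.
Local Open Scope quotient_scope.

(* The ring F[U]; the variable 'X plays the role of U. *)
Notation FU := {poly 'F_2}.

Section QuotientModule.
Variables (R : comNzRingType) (V : lmodType R) (S : submodClosed V).

(* S again, as a predicate known to be closed under opposite, as required by
   the additive quotients of the library. *)
Definition zmod_pred : {pred V} := fun x => x \in S.
Fact zmod_pred_closed : zmod_closed zmod_pred.
Proof.
have S0 : 0 \in S by rewrite rpred0.
split=> // x y xS yS; suff : x - y \in S by [].
have {}xS : x \in S by []; have {}yS : y \in S by [].
by rewrite rpredD // -scaleN1r rpredZ.
Qed.
HB.instance Definition _ := GRing.isZmodClosed.Build V zmod_pred zmod_pred_closed.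

Definition quotmod : Type := (Quotient.quot zmod_pred).
HB.instance Definition _ := GRing.Zmodule.on quotmod.

Definition qclass (x : V) : quotmod := \pi_((Quotient.quot zmod_pred)) x.
Definition qrepr (q : quotmod) : V := repr (q : (Quotient.quot zmod_pred)).

Lemma qreprK : cancel qrepr qclass.
Proof. by move=> q; rewrite /qclass /qrepr reprK. Qed.

Lemma qclass_eq x y : (qclass x = qclass y) <-> (x - y \in S).
Proof.
rewrite /qclass.
by split=> [/eqP|h]; [|apply/eqP]; rewrite -Quotient.idealrBE.
Qed.

Lemma qclassD x y : qclass (x + y) = qclass x + qclass y.
Proof. by rewrite /qclass raddfD. Qed.

Lemma qclass_repr x : qrepr (qclass x) - x \in S.
Proof. by apply/qclass_eq; rewrite qreprK. Qed.

Definition qscale (a : R) (q : quotmod) : quotmod := qclass (a *: qrepr q).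

Lemma qscaleE a x : qscale a (qclass x) = qclass (a *: x).
Proof. by apply/qclass_eq; rewrite -scalerBr rpredZ // qclass_repr. Qed.

Fact qscaleA a b q : qscale a (qscale b q) = qscale (a * b) q.
Proof. by rewrite -[q]qreprK !qscaleE scalerA. Qed.
Fact qscale1 : left_id 1 qscale.
Proof. by move=> q; rewrite -[q]qreprK qscaleE scale1r. Qed.
Fact qscaleDr : right_distributive qscale +%R.
Proof.
by move=> a p q; rewrite -[p]qreprK -[q]qreprK -qclassD !qscaleE scalerDr qclassD.
Qed.
Fact qscaleDl q : {morph qscale^~ q : a b / a + b}.
Proof. by move=> a b; rewrite -[q]qreprK !qscaleE scalerDl qclassD. Qed.
HB.instance Definition _ := GRing.Zmodule_isLmodule.Build R quotmod
  qscaleA qscale1 qscaleDr qscaleDl.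

Lemma qclassZ a x : qclass (a *: x) = a *: qclass x.
Proof. by rewrite -qscaleE. Qed.

Fact qclass_linear : linear qclass.
Proof. by move=> a x y; rewrite qclassD qclassZ. Qed.
HB.instance Definition _ := GRing.isLinear.Build R V quotmod _ qclass qclass_linear.

End QuotientModule.

(* The localization U^{-1} M = F[U,U^{-1}] (x) M, as fractions x / U^n. It is
   kept as an F[U]-module; U acts invertibly, so F[U]-linear maps between such
   modules are automatically F[U,U^{-1}]-linear. *)
Section Localization.
Variable M : lmodType FU.

Definition loc_rel (p q : M * nat) : bool :=
  `[< exists k : nat, 'X^(k + q.2) *: p.1 = 'X^(k + p.2) *: q.1 >].

Fact loc_rel_refl : reflexive loc_rel.
Proof. by move=> p; apply/asboolP; exists 0%N. Qed.
Fact loc_rel_sym : symmetric loc_rel.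
Proof. by move=> p q; apply/asboolP/asboolP=> -[k e]; exists k; apply: esym. Qed.
Fact loc_rel_trans : transitive loc_rel.
Proof.
move=> [y n] [x m] [z l] /asboolP[i /= e1] /asboolP[j /= e2].
apply/asboolP; exists (i + j + n)%N => /=.
have -> : 'X^(i + j + n + l) *: x = 'X^(j + l) *: ('X^(i + n) *: x).
  by rewrite scalerA -exprD; congr ('X^_ *: _); lia.
rewrite e1 scalerA -exprD addnC exprD -scalerA.
have -> : 'X^(i + m) *: ('X^(j + l) *: y) = 'X^(i + m) *: ('X^(j + n) *: z).
  by rewrite e2.
by rewrite scalerA -exprD; congr ('X^_ *: _); lia.
Qed.
Canonical loc_equiv := EquivRel loc_rel loc_rel_refl loc_rel_sym loc_rel_trans.
Canonical loc_encModRel := defaultEncModRel loc_rel.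

Definition loc : Type := {eq_quot loc_rel}.
HB.instance Definition _ := Choice.on loc.

Definition frac (x : M) (n : nat) : loc := \pi_({eq_quot loc_rel}) (x, n).
Definition numer (u : loc) : M := (repr (u : {eq_quot loc_rel})).1.
Definition denom (u : loc) : nat := (repr (u : {eq_quot loc_rel})).2.

Lemma fracK u : frac (numer u) (denom u) = u.
Proof.
rewrite /frac /numer /denom -[RHS](@reprK _ {eq_quot loc_rel} u).
by case: (repr _).
Qed.

Lemma frac_eq x m y n : (frac x m = frac y n) <->
  exists k : nat, 'X^(k + n) *: x = 'X^(k + m) *: y.
Proof.
rewrite /frac; split=> [/eqP|h]; [|apply/eqP]; rewrite piE /=.
  by move/asboolP.
by apply/asboolP.
Qed.

Lemma fracX k x m : frac ('X^k *: x) (k + m) = frac x m.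
Proof.
by apply/frac_eq; exists 0%N; rewrite scalerA -exprD; congr ('X^_ *: _); lia.
Qed.

Definition loc_add (u v : loc) : loc :=
  frac ('X^(denom v) *: numer u + 'X^(denom u) *: numer v) (denom u + denom v).
Definition loc_scale (a : FU) (u : loc) : loc := frac (a *: numer u) (denom u).

Lemma loc_scaleE a x m : loc_scale a (frac x m) = frac (a *: x) m.
Proof.
have /frac_eq[k e] := fracK (frac x m).
apply/frac_eq; exists k.
by rewrite !scalerA ![_ * a]mulrC -!scalerA e.
Qed.

Lemma loc_addE x m y n :
  loc_add (frac x m) (frac y n) = frac ('X^n *: x + 'X^m *: y) (m + n).
Proof.
have /frac_eq[i e1] := fracK (frac x m).
have /frac_eq[j e2] := fracK (frac y n).
rewrite /loc_add; move: (frac x m) (frac y n) e1 e2 => u v.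
move: (numer u) (denom u) (numer v) (denom v) => x' m' y' n' e1 e2; apply/frac_eq; exists (i + j)%N.
rewrite !scalerDr !scalerA -!exprD; congr (_ + _).
- transitivity ('X^(j + n + n') *: ('X^(i + m) *: x')).
    by rewrite scalerA -exprD; congr ('X^_ *: _); lia.
  by rewrite e1 scalerA -exprD; congr ('X^_ *: _); lia.
- transitivity ('X^(i + m + m') *: ('X^(j + n) *: y')).
    by rewrite scalerA -exprD; congr ('X^_ *: _); lia.
  by rewrite e2 scalerA -exprD; congr ('X^_ *: _); lia.
Qed.

Lemma loc_addE_same x y m : loc_add (frac x m) (frac y m) = frac (x + y) m.
Proof. by rewrite loc_addE -scalerDr fracX. Qed.

Fact loc_addA : associative loc_add.
Proof.
move=> u v w; rewrite -[u]fracK -[v]fracK -[w]fracK !loc_addE !scalerDr.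
by rewrite !scalerA -!exprD !addrA ![(denom w + _)%N]addnC !addnA.
Qed.
Fact loc_addC : commutative loc_add.
Proof.
by move=> u v; rewrite -[u]fracK -[v]fracK !loc_addE addrC addnC.
Qed.
Fact loc_add0 : left_id (frac 0 0) loc_add.
Proof.
by move=> u; rewrite -[u]fracK loc_addE scaler0 add0r expr0 scale1r.
Qed.
Fact loc_addN : left_inverse (frac 0 0) (loc_scale (-1)) loc_add.
Proof.
move=> u; rewrite -[u]fracK loc_scaleE loc_addE_same scaleN1r addNr.
by apply/frac_eq; exists 0%N; rewrite !scaler0.
Qed.
HB.instance Definition _ :=
  GRing.isZmodule.Build loc loc_addA loc_addC loc_add0 loc_addN.

Fact loc_scaleA a b u : loc_scale a (loc_scale b u) = loc_scale (a * b) u.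
Proof. by rewrite -[u]fracK !loc_scaleE scalerA. Qed.
Fact loc_scale1 : left_id 1 loc_scale.
Proof. by move=> u; rewrite -[u]fracK loc_scaleE scale1r. Qed.
Fact loc_scaleDr : right_distributive loc_scale +%R.
Proof.
move=> a u v; rewrite -[u]fracK -[v]fracK /+%R /= loc_addE !loc_scaleE loc_addE.
by rewrite scalerDr !scalerA ![a * _]mulrC.
Qed.
Fact loc_scaleDl u : {morph loc_scale^~ u : a b / a + b}.
Proof.
by move=> a b; rewrite -[u]fracK !loc_scaleE [RHS]loc_addE_same scalerDl.
Qed.
HB.instance Definition _ := GRing.Zmodule_isLmodule.Build FU loc
  loc_scaleA loc_scale1 loc_scaleDr loc_scaleDl.

(* The grading on the localization induced by a grading on M: deg U^{-n} = 2n. *)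
Definition loc_homog (P : int -> M -> Prop) (k : int) (u : loc) : Prop :=
  exists (x : M) (n : nat), P (k - (n.*2)%:Z) x /\ u = frac x n.

End Localization.

Section LocMap.
Variables (M N : lmodType FU) (f : M -> N).

Definition loc_map (u : loc M) : loc N := frac (f (numer u)) (denom u).

Lemma loc_map_frac (fZ : forall (a : FU) x, f (a *: x) = a *: f x) x n :
  loc_map (frac x n) = frac (f x) n.
Proof.
have /frac_eq[k e] := fracK (frac x n).
by apply/frac_eq; exists k; rewrite -!fZ e.
Qed.

End LocMap.

(* F[U] graded with deg U = -2, and F[U,U^{-1}] as its localization. *)
Definition poly_homog (k : int) (p : FU^o) : Prop :=
  forall j : nat, (p : FU)`_j != 0 -> k = - (j.*2)%:Z.

Notation Laurent := (loc FU^o).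

(* The free module F[U]^r whose i-th basis vector has degree deg i; the zero
   vector is homogeneous of every degree. *)
Definition homog (r : nat) (deg : 'I_r -> int) (k : int) (x : 'rV[FU]_r) : Prop :=
  forall (i : 'I_r) (j : nat), (x 0 i)`_j != 0 -> k = deg i - (j.*2)%:Z.

(* Free, finitely generated, Z-graded chain complexes over F[U], presented on
   a homogeneous basis. Maps below are not required to respect the basis. *)
Record complex := Complex {
  rank : nat;
  deg : 'I_rank -> int;
  diff : {linear 'rV[FU]_rank -> 'rV[FU]_rank};
  diff_homog : forall k x, homog deg k x -> homog deg (k - 1) (diff x);
  diffK : forall x, diff (diff x) = 0
}.

Notation carrier C := 'rV[FU]_(rank C).

Definition has_degree (C1 C2 : complex) (s : int) (f : carrier C1 -> carrier C2) :=
  forall k x, homog (@deg C1) k x -> homog (@deg C2) (k + s) (f x).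

Section Homology.
Variable C : complex.

Definition is_cycle : {pred carrier C} := fun z => diff C z == 0.

Fact is_cycle_submod : submod_closed is_cycle.
Proof.
split=> [|a x y]; rewrite !unfold_in; first by rewrite linear0.
by move=> /eqP ex /eqP ey; rewrite linearP ex ey scaler0 addr0.
Qed.
HB.instance Definition _ :=
  GRing.isSubmodClosed.Build FU (carrier C) is_cycle
    (GRing.submod_closed_semi is_cycle_submod).

Record cycle := Cycle { cycle_val : carrier C; _ : cycle_val \in is_cycle }.
HB.instance Definition _ := [isSub for cycle_val].
HB.instance Definition _ := [Choice of cycle by <:].
HB.instance Definition _ := [SubChoice_isSubLmodule of cycle by <:].

Definition is_boundary : {pred cycle} :=
  fun z => `[< exists x, diff C x = val z >].

Fact is_boundary_submod : submod_closed is_boundary.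
Proof.
split=> [|a x y]; rewrite !unfold_in.
  by apply/asboolP; exists 0; rewrite linear0.
move=> /asboolP[x' ex] /asboolP[y' ey]; apply/asboolP; exists (a *: x' + y').
by rewrite linearP ex ey.
Qed.
HB.instance Definition _ :=
  GRing.isSubmodClosed.Build FU cycle is_boundary
    (GRing.submod_closed_semi is_boundary_submod).

Definition homology : lmodType FU := quotmod is_boundary.

Definition hclass (z : cycle) : homology := qclass is_boundary z.

Definition homology_homog (k : int) (h : homology) : Prop :=
  exists z : cycle, homog (@deg C) k (val z) /\ h = hclass z.

Definition nontorsion (h : homology) : Prop :=
  forall n : nat, ('X^n : FU) *: h <> 0.

End Homology.

Record chain_map (C1 C2 : complex) := ChainMap {
  chain_fun :> {linear carrier C1 -> carrier C2};
  chain_degree : has_degree 0 chain_fun;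
  chain_comm : forall x, chain_fun (diff C1 x) = diff C2 (chain_fun x)
}.

Section InducedMap.
Variables (C1 C2 : complex) (f : chain_map C1 C2).

Fact cycle_map_subproof (z : cycle C1) : f (val z) \in @is_cycle C2.
Proof.
case: z => z zP /=; move: zP; rewrite !unfold_in => /eqP dz.
by rewrite -chain_comm dz linear0.
Qed.
Definition cycle_map (z : cycle C1) : cycle C2 := Cycle (cycle_map_subproof z).

Definition homology_map (h : homology C1) : homology C2 :=
  hclass (cycle_map (qrepr h)).

Lemma homology_map_class z : homology_map (hclass z) = hclass (cycle_map z).
Proof.
apply/qclass_eq; have := qclass_repr (@is_boundary C1) z.
rewrite !unfold_in => /asboolP[x ex]; apply/asboolP; exists (f x).
rewrite -chain_comm ex; exact: linearB.
Qed.

Lemma homology_mapZ (a : FU) h : homology_map (a *: h) = a *: homology_map h.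
Proof.
rewrite -[h]qreprK -qclassZ !homology_map_class -qclassZ.
by congr hclass; apply: val_inj; rewrite /= linearZ.
Qed.

Definition loc_homology_map : loc (homology C1) -> loc (homology C2) :=
  loc_map homology_map.

Lemma loc_homology_mapE z n :
  loc_homology_map (frac (hclass z) n) = frac (hclass (cycle_map z)) n.
Proof.
by rewrite /loc_homology_map loc_map_frac ?homology_map_class //; apply: homology_mapZ.
Qed.

End InducedMap.

Definition in_imU (r s : nat) (f : 'rV[FU]_r -> 'rV[FU]_s) : Prop :=
  forall x, exists y, f x = 'X *: y.

Definition homotopic_modU (C1 C2 : complex) (f g : carrier C1 -> carrier C2) : Prop :=
  exists H : {linear carrier C1 -> carrier C2},
    has_degree 1 H /\
    in_imU (fun x => f x + g x + H (diff C1 x) + diff C2 (H x)).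

(* The isomorphism U^{-1}H_*(C) = F[U,U^{-1}] is one of relatively graded
   modules: it may shift the grading. *)
Record almost_iota := AlmostIota {
  ai_complex :> complex;
  ai_iota : {linear carrier ai_complex -> carrier ai_complex};
  ai_loc : exists (phi : {linear loc (homology ai_complex) -> Laurent}) (s : int),
    bijective phi /\
    forall k u, loc_homog (@homology_homog ai_complex) k u ->
      loc_homog poly_homog (k + s) (phi u);
  ai_even : forall (k : int) (u : loc (homology ai_complex)),
    loc_homog (@homology_homog ai_complex) k u -> u != 0 -> (2 %| k)%Z;
  ai_normalized :
    (exists h : homology ai_complex, homology_homog 0 h /\ nontorsion h) /\
    (forall k (h : homology ai_complex), homology_homog k h -> nontorsion h -> k <= 0);
  ai_iota_degree : has_degree 0 ai_iota;
  ai_iota_comm :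
    in_imU (fun x => ai_iota (diff ai_complex x) + diff ai_complex (ai_iota x));
  ai_iota_square : homotopic_modU (ai_iota \o ai_iota) idfun
}.

Definition is_almost_iota_morphism (A B : almost_iota) (f : chain_map A B) : Prop :=
  homotopic_modU (f \o ai_iota A) (ai_iota B \o f).

Definition is_local_map (A B : almost_iota) (f : chain_map A B) : Prop :=
  is_almost_iota_morphism f /\ bijective (loc_homology_map f).

Definition local_le (A B : almost_iota) : Prop :=
  exists f : chain_map A B, is_local_map f.

Definition locally_equivalent (A B : almost_iota) : bool :=
  `[< local_le A B /\ local_le B A >].

Section LocalOrder.

Lemma has_degree_comp (C1 C2 C3 : complex) s t (f : carrier C1 -> carrier C2)
    (g : carrier C2 -> carrier C3) :
  has_degree s f -> has_degree t g -> has_degree (s + t) (g \o f).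
Proof. by move=> hf hg k x /hf/hg; rewrite addrA. Qed.

Lemma homogD r (e : 'I_r -> int) k x y :
  homog e k x -> homog e k y -> homog e k (x + y).
Proof.
move=> hx hy i j; rewrite mxE coefD.
by have [/eqP ->|/hx//] := boolP ((x 0 i)`_j == 0); rewrite add0r => /hy.
Qed.

Fact id_degree (C : complex) :
  has_degree 0 (idfun : {linear carrier C -> carrier C}).
Proof. by move=> k x; rewrite addr0. Qed.
Definition id_chain (C : complex) : chain_map C C :=
  ChainMap (@id_degree C) (fun=> erefl).

Section Comp.
Variables (C1 C2 C3 : complex) (g : chain_map C2 C3) (f : chain_map C1 C2).
Fact comp_degree : has_degree 0 (g \o f : {linear carrier C1 -> carrier C3}).
Proof. by have := has_degree_comp (@chain_degree _ _ f) (@chain_degree _ _ g); rewrite addr0. Qed.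
Fact comp_comm x : (g \o f) (diff C1 x) = diff C3 ((g \o f) x).
Proof. by rewrite /= !chain_comm. Qed.
Definition comp_chain : chain_map C1 C3 := ChainMap comp_degree comp_comm.
End Comp.

Lemma addFU r (x : 'rV[FU]_r) : x + x = 0.
Proof.
by apply/rowP=> i; rewrite !mxE; apply/polyP=> j;
   rewrite coefD coef0 addrr_pchar2 ?pchar_Fp.
Qed.

Lemma local_le_refl A : local_le A A.
Proof.
exists (id_chain A); split.
  exists \0; split; first by move=> k x _ i j; rewrite !mxE coef0 eqxx.
  by move=> x; exists 0; rewrite /= addFU scaler0 !add0r linear0.
have e u : loc_homology_map (id_chain A) u = u.
  rewrite -[u]fracK -[numer u]qreprK [LHS]loc_homology_mapE.
  by congr (frac (hclass _) _); apply: val_inj.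
by exists id => u; rewrite e.
Qed.

Lemma local_le_trans A B C : local_le A B -> local_le B C -> local_le A C.
Proof.
move=> [f [[H [dH eH]] bf]] [g [[K [dK eK]] bg]].
exists (comp_chain g f); split.
  exists ((g \o H) \+ (K \o f)); split.
    move=> k x hx; apply: homogD.
      by have := has_degree_comp dH (@chain_degree _ _ g); rewrite addr0; apply.
    by have := has_degree_comp (@chain_degree _ _ f) dK; rewrite add0r; apply.
  move=> x; have [y ey] := eH x; have [z ez] := eK (f x).
  exists (g y + z); rewrite scalerDr -ez -linearZ -ey /= !linearD /= !chain_comm.
  rewrite [RHS](AC (4*4) ((2*5)*(1*6*(3*7)*(4*8)))) /=.
  by have -> := addFU (g (ai_iota B (f x))); rewrite add0r.
have e u : loc_homology_map (comp_chain g f) u =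
           loc_homology_map g (loc_homology_map f u).
  rewrite -[u]fracK -[numer u]qreprK -/(hclass _) !loc_homology_mapE.
  have -> // : cycle_map (comp_chain g f) (qrepr (numer u)) =
               cycle_map g (cycle_map f (qrepr (numer u))) by apply: val_inj.
exact: eq_bij (bij_comp bg bf) _ (fun u => esym (e u)).
Qed.

Fact locally_equivalent_refl : reflexive locally_equivalent.
Proof. by move=> A; apply/asboolP; split; apply: local_le_refl. Qed.
Fact locally_equivalent_sym : symmetric locally_equivalent.
Proof. by move=> A B; apply/asboolP/asboolP=> -[]. Qed.
Fact locally_equivalent_trans : transitive locally_equivalent.
Proof.
move=> B A C /asboolP[ab ba] /asboolP[bc cb]; apply/asboolP.
by split; [apply: local_le_trans ab bc|apply: local_le_trans cb ba].
Qed.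

End LocalOrder.

HB.instance Definition _ := gen_eqMixin almost_iota.
HB.instance Definition _ := gen_choiceMixin almost_iota.

Canonical locally_equivalent_equiv := EquivRel locally_equivalent
  locally_equivalent_refl locally_equivalent_sym locally_equivalent_trans.
Canonical locally_equivalent_encModRel := defaultEncModRel locally_equivalent.

(* Almost iota-complexes modulo local equivalence. *)
Definition Ihat : Type := {eq_quot locally_equivalent}.
HB.instance Definition _ := Choice.on Ihat.

Definition local_class (A : almost_iota) : Ihat :=
  \pi_({eq_quot locally_equivalent}) A.
Definition local_repr (X : Ihat) : almost_iota :=
  repr (X : {eq_quot locally_equivalent}).

Lemma local_reprK : cancel local_repr local_class.
Proof. by move=> X; rewrite /local_class /local_repr reprK. Qed.

Lemma local_class_eq A B :
  (local_class A = local_class B) <-> (local_le A B /\ local_le B A).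
Proof.
rewrite /local_class; split=> [/eqP|h]; [|apply/eqP]; rewrite piE /=.
  by move/asboolP.
by apply/asboolP.
Qed.

Definition Ihat_le (X Y : Ihat) : bool :=
  `[< local_le (local_repr X) (local_repr Y) >].

Fact Ihat_le_refl : reflexive Ihat_le.
Proof. by move=> X; apply/asboolP; apply: local_le_refl. Qed.
Fact Ihat_le_anti : antisymmetric Ihat_le.
Proof.
move=> X Y /andP[/asboolP xy /asboolP yx].
by rewrite -[X]local_reprK -[Y]local_reprK; apply/local_class_eq.
Qed.
Fact Ihat_le_trans : transitive Ihat_le.
Proof.
by move=> Y X Z /asboolP xy /asboolP yz; apply/asboolP; apply: local_le_trans xy yz.
Qed.

Fact Ihat_display : Order.disp_t. Proof. exact: Order.Disp tt tt. Qed.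
HB.instance Definition _ := Order.Le_isPOrder.Build Ihat_display Ihat
  Ihat_le_refl Ihat_le_anti Ihat_le_trans.

Lemma le_local_class A B :
  (local_class A <= local_class B)%O <-> local_le A B.
Proof.
have /local_class_eq[a1 a2] := local_reprK (local_class A).
have /local_class_eq[b1 b2] := local_reprK (local_class B).
split=> [/asboolP h|h]; last apply/asboolP.
  exact: local_le_trans a2 (local_le_trans h b1).
exact: local_le_trans a1 (local_le_trans h b2).
Qed.

(* Main.v *)
From HB Require Import structures.
From mathcomp Require Import all_boot all_order all_algebra.
From mathcomp Require Import boolp zify ring.
Require Import Defs.

Set Implicit Arguments.
Unset Strict Implicit.
Unset Printing Implicit Defensive.

Import Order.TTheory GRing.Theory Num.Theory.

Local Open Scope ring_scope.

(** Setting U = 1 turns a homogeneous F[U]-linear map between graded free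
modules into a matrix over the field F with two elements. Such a map of degree
s is recovered from its matrix, whose (i, j) entry may be nonzero only if
deg j - deg i - s is even and nonnegative, and the map lies in im U exactly when
its matrix satisfies this condition for s + 2. So an almost iota-complex becomes
a filtered F-vector space, and the theorem becomes one about matrices.

Let A and B be almost iota-complexes. Write D_s for the matrices of degree s
maps from A to B, bdry for the differential of Hom(A, B), and
commutator u = iota u + u iota. The normalization of gradings gives B a
nontorsion cycle t of degree 0 ([tower]) and gives A a degree 0 cocycle c
([cotower]) taking the value 1 on its own such cycle; together they give the
rank one chain map x |-> c(x) t, the [tower_map]. Consider the subspace Q of all
a + bdry x + commutator v, with a in D_2, x of odd degree, and v in D_0 with
bdry v in D_1 ([obstruction]).

If the tower map lies in Q, then a + commutator v is homologous to it, hence is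
a chain map that still sends the tower to a nontorsion class. It commutes with
iota up to homotopy mod U, because the commutator operation squares to zero up
to homotopy: its square is v |-> iota^2 v + v iota^2, and iota^2 is homotopic to
the identity mod U. This gives a local map from A to B ([obstruction_local]).

If it does not, linear algebra provides a functional on matrices that vanishes
on Q and takes the value 1 on the tower map. The trace pairing identifies it
with a matrix y from B to A. Vanishing on D_2 says that y respects the
filtration; vanishing on boundaries says that y is a chain map; vanishing on
the commutators says, after a second separation argument, that the commutator
of y with iota is null-homotopic mod U; the value 1 says that the cocycle of A
equals 1 on the image under y of the tower of B, so that image is nontorsion.
Thus y is a local map from B to A ([unobstructed_local]).

Finally, localized homology is free of rank one over F[U, U^-1], so a chain map
that sends one nontorsion class of degree 0 to a nontorsion class is an
isomorphism on it ([generates_bij]). *)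

(** * Separation by the trace pairing *)

Section Separation.
Variable F : finFieldType.

Lemma mxtrace_delta m n (y : 'M[F]_(n, m)) i j :
  \tr (y *m delta_mx i j) = y j i.
Proof.
rewrite /mxtrace (bigD1 j) //= big1 => [|k kj].
  rewrite addr0 mxE (bigD1 i) //= big1 => [|l li].
    by rewrite mxE !eqxx mulr1 addr0.
  by rewrite mxE (negPf li) mulr0.
by rewrite mxE big1 // => l _; rewrite mxE (negPf kj) andbF mulr0.
Qed.

Lemma functional_trace m n (c : 'cV[F]_(m * n)) :
  exists y : 'M_(n, m), forall u, mxvec u *m c = (\tr (y *m u))%:M.
Proof.
exists (\matrix_(j, i) (mxvec (delta_mx i j) *m c) 0 0) => u.
rewrite {1 2}[u]matrix_sum_delta mulmx_sumr !linear_sum /= mulmx_suml.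
rewrite raddf_sum /=; apply: eq_bigr => i _.
rewrite mulmx_sumr !linear_sum /= mulmx_suml.
rewrite raddf_sum /=; apply: eq_bigr => j _.
rewrite -scalemxAr !linearZ /= -scalemxAl -scale_scalar_mx; congr (_ *: _).
by rewrite mxtrace_delta mxE [LHS]mx11_scalar.
Qed.

(** Over a finite field the subspace P is the row space of the matrix listing
its elements, and the columns of a cokernel matrix are functionals cutting out
that row space. *)
Lemma trace_separation m n (P : 'M[F]_(m, n) -> Prop) x :
    P 0 -> (forall a u v, P u -> P v -> P (a *: u + v)) -> ~ P x ->
  exists2 y : 'M_(n, m), forall u, P u -> \tr (y *m u) = 0 & \tr (y *m x) = 1.
Proof.
move=> P0 Plin Px.
pose A := [pred u | `[< P u >]].
pose G := \matrix_(i < #|A|) mxvec (enum_val i).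
have xG : ~~ (mxvec x <= G)%MS.
  apply/negP => /submxP[c xc]; apply: Px.
  rewrite -[x]mxvecK xc mulmx_sum_row linear_sum /=.
  elim/big_rec: _ => // i v _ Pv; rewrite linearZ; apply: Plin => //=.
  by rewrite rowK mxvecK; apply/asboolP; apply: (enum_valP i).
move: xG; rewrite submxE => /matrix0Pn[i0 [j]]; rewrite [i0]ord1 => cj.
pose a := (mxvec x *m cokermx G) 0 j.
have [y gy] := functional_trace (a^-1 *: col j (cokermx G)).
have {}gy u : \tr (y *m u) = a^-1 * (mxvec u *m cokermx G) 0 j.
  have /matrixP/(_ 0 0) := gy u; rewrite -scalemxAr colE mulmxA -colE !mxE eqxx mulr1n.
  by move<-.
exists y => [u Pu|]; last by rewrite gy mulVf.
suff : (mxvec u <= G)%MS by rewrite gy submxE => /eqP ->; rewrite mxE mulr0.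
have uA : u \in A by apply/asboolP.
rewrite -(enum_rankK_in uA uA) -(rowK (fun i => mxvec (enum_val i))).
exact: row_sub.
Qed.

Definition supported m n (S : 'I_m -> 'I_n -> bool) (M : 'M[F]_(m, n)) : Prop :=
  forall i j, M i j != 0 -> S i j.

Definition restrict m n (S : 'I_m -> 'I_n -> bool) (M : 'M[F]_(m, n)) :=
  \matrix_(i, j) if S i j then M i j else 0.

Lemma supported_eq0 m n (S : 'I_m -> 'I_n -> bool) (M : 'M[F]_(m, n)) i j :
  supported S M -> ~~ S i j -> M i j = 0.
Proof. by move=> SM nS; apply/eqP; apply: contraNT nS => /SM. Qed.

Lemma supported0 m n (S : 'I_m -> 'I_n -> bool) : supported S (0 : 'M[F]_(m, n)).
Proof. by move=> i j; rewrite mxE eqxx. Qed.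

Lemma supportedP m n (S : 'I_m -> 'I_n -> bool) a (M N : 'M[F]_(m, n)) :
  supported S M -> supported S N -> supported S (a *: M + N).
Proof.
move=> SM SN i j; apply: contraNT => nS.
by rewrite !mxE !(supported_eq0 _ nS) // mulr0 addr0.
Qed.

Lemma supportedD m n (S : 'I_m -> 'I_n -> bool) (M N : 'M[F]_(m, n)) :
  supported S M -> supported S N -> supported S (M + N).
Proof. by move=> SM SN; rewrite -[M]scale1r; apply: supportedP. Qed.

Lemma supportedM m n p (S : 'I_m -> 'I_n -> bool) (T : 'I_n -> 'I_p -> bool)
    (R : 'I_m -> 'I_p -> bool) (M : 'M[F]_(m, n)) (N : 'M[F]_(n, p)) :
    (forall i j k, S i j -> T j k -> R i k) ->
  supported S M -> supported T N -> supported R (M *m N).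
Proof.
move=> STR SM TN i k; have [//|nR] := boolP (R i k).
rewrite mxE big1 ?eqxx // => j _; apply/eqP; rewrite mulf_eq0.
apply/contraNT: nR; rewrite negb_or => /andP[/SM Sij /TN Tjk].
exact: STR Sij Tjk.
Qed.

Lemma restrict_supported m n (S : 'I_m -> 'I_n -> bool) (M : 'M[F]_(m, n)) :
  supported S (restrict S M).
Proof. by move=> i j; rewrite mxE; case: ifP; rewrite ?eqxx. Qed.

Lemma restrict_id m n (S : 'I_m -> 'I_n -> bool) (M : 'M[F]_(m, n)) :
  supported S M -> restrict S M = M.
Proof.
move=> SM; apply/matrixP => i j; rewrite mxE; case: ifP => // nS.
by apply/esym/eqP/negPn/negP => /SM; rewrite nS.
Qed.

Lemma restrictP m n (S : 'I_m -> 'I_n -> bool) a (M N : 'M[F]_(m, n)) :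
  restrict S (a *: M + N) = a *: restrict S M + restrict S N.
Proof.
by apply/matrixP => i j; rewrite !mxE; case: ifP => //; rewrite mulr0 add0r.
Qed.

Lemma restrict_delta m n (S : 'I_m -> 'I_n -> bool) i j :
  restrict S (delta_mx i j : 'M[F]_(m, n)) = if S i j then delta_mx i j else 0.
Proof.
apply/matrixP => k l; rewrite mxE mxE; case: (boolP (S i j)) => Sij.
  have [/andP[/eqP-> /eqP->]|/negPf kl] := boolP ((k == i) && (l == j)).
    by rewrite Sij mxE !eqxx.
  by rewrite mxE kl; case: ifP.
have [/andP[/eqP-> /eqP->]|/negPf kl] := boolP ((k == i) && (l == j)).
  by rewrite (negPf Sij) mxE.
by rewrite mxE; case: ifP.
Qed.

(** Orthogonality to all matrices supported on S forces the complementary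
support; membership of a dual matrix in a filtration step is read off from
this. *)
Lemma supported_pairing m n (S : 'I_m -> 'I_n -> bool) (y : 'M[F]_(n, m)) :
    (forall u, supported S u -> \tr (y *m u) = 0) ->
  supported (fun j i => ~~ S i j) y.
Proof.
move=> yS j i; apply: contra => Sij; rewrite -mxtrace_delta yS //.
by move=> k l; rewrite mxE; case: andP => [[/eqP-> /eqP->]|]; rewrite ?eqxx.
Qed.

(** Applying the separation lemma to the matrices whose restriction to S is in
P makes the separating matrix vanish outside the transpose of S. It is used
with S a parity condition on degrees. *)
Lemma supported_trace_separation m n (S : 'I_m -> 'I_n -> bool)
    (P : 'M[F]_(m, n) -> Prop) x :
    P 0 -> (forall a u v, P u -> P v -> P (a *: u + v)) ->
    supported S x -> ~ P x ->
  exists y : 'M_(n, m), [/\ supported (fun j i => S i j) y,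
    forall u, P u -> supported S u -> \tr (y *m u) = 0 & \tr (y *m x) = 1].
Proof.
move=> P0 Plin Sx nPx; pose Q u := P (restrict S u).
have [||| y yQ yx] := @trace_separation m n Q x.
- by rewrite /Q (restrict_id (@supported0 _ _ _)).
- by move=> a u v Pu Pv; rewrite /Q restrictP; apply: Plin.
- by rewrite /Q restrict_id.
exists y; split => // [|u Pu Su]; last by apply: yQ; rewrite /Q restrict_id.
move=> j i; apply/contraNT => nS; rewrite -mxtrace_delta yQ // /Q.
by rewrite restrict_delta (negPf nS).
Qed.

End Separation.

Notation F2 := 'F_2.

(** * Filtered matrices over the field with two elements *)

(** The positions (i, j) where a map of degree s can have a nonzero coefficient
U^k: the basis vector of degree e i goes to degree e i + s, and
f j - 2k = e i + s. *)
Definition graded_entry m n (e : 'I_m -> int) (f : 'I_n -> int) (s : int) i j :=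
  (0 <= f j - e i - s) && (2 %| f j - e i - s)%Z.

Definition parity_entry m n (e : 'I_m -> int) (f : 'I_n -> int) (s : int) i j :=
  (2 %| f j - e i - s)%Z.

Notation filtered e f s := (@supported F2 _ _ (graded_entry e f s)).
Notation of_parity e f s := (@supported F2 _ _ (parity_entry e f s)).

Lemma supported_sub (F : finFieldType) m n (S T : 'I_m -> 'I_n -> bool)
    (M : 'M[F]_(m, n)) :
  (forall i j, S i j -> T i j) -> supported S M -> supported T M.
Proof. by move=> ST SM i j /SM/ST. Qed.

Lemma filteredM r s t m n p (e : 'I_m -> int) (f : 'I_n -> int) (g : 'I_p -> int)
    (M : 'M_(m, n)) (N : 'M_(n, p)) :
  r = s + t -> filtered e f s M -> filtered f g t N -> filtered e g r (M *m N).
Proof. by move=> ->; apply: supportedM => i j k; rewrite /graded_entry; lia. Qed.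

Lemma of_parityM r s t m n p (e : 'I_m -> int) (f : 'I_n -> int) (g : 'I_p -> int)
    (M : 'M_(m, n)) (N : 'M_(n, p)) :
  r = s + t -> of_parity e f s M -> of_parity f g t N -> of_parity e g r (M *m N).
Proof. by move=> ->; apply: supportedM => i j k; rewrite /parity_entry; lia. Qed.

Lemma filtered_parity s m n (e : 'I_m -> int) (f : 'I_n -> int) (M : 'M_(m, n)) :
  filtered e f s M -> of_parity e f s M.
Proof. by apply: supported_sub => i j /andP[]. Qed.

Lemma filtered_lower s m n (e : 'I_m -> int) (f : 'I_n -> int) (M : 'M_(m, n)) :
  filtered e f (s + 2) M -> filtered e f s M.
Proof. by apply: supported_sub => i j; rewrite /graded_entry; lia. Qed.

Lemma addF2 (x : F2) : x + x = 0.
Proof. by rewrite addrr_pchar2 ?pchar_Fp. Qed.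

Lemma addmF2 m n (M : 'M[F2]_(m, n)) : M + M = 0.
Proof. by apply/matrixP => i j; rewrite !mxE addF2. Qed.

Lemma addmF2_eq m n (M N : 'M[F2]_(m, n)) : M + N = 0 <-> M = N.
Proof.
split=> [MN|->]; last exact: addmF2.
by rewrite -[N]add0r -MN -addrA addmF2 addr0.
Qed.

Lemma addmF2_shift m n (M N K : 'M[F2]_(m, n)) : M + K = M + N + K + N.
Proof. by rewrite [M + N + K]addrAC -[RHS]addrA addmF2 addr0. Qed.

Lemma mxtrace_adjoint m n (y : 'M[F2]_(n, m)) a b (u : 'M_(m, n)) :
  \tr (y *m (a *m u + u *m b)) = \tr ((b *m y + y *m a) *m u).
Proof.
rewrite mulmxDr mulmxDl !mxtraceD !mulmxA addrC; congr (_ + _).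
by rewrite mxtrace_mulC mulmxA.
Qed.

(** * Matrices of local maps *)

(** An almost iota-complex at U = 1, with matrices acting on row vectors. The
tower is a degree 0 cycle, the cotower a degree 0 chain map to F[U] that sends
the tower to 1. *)
Record filtered_model := FilteredModel {
  msize : nat;
  mdeg : 'I_msize -> int;
  diff_mx : 'M[F2]_msize;
  iota_mx : 'M[F2]_msize;
  htpy_mx : 'M[F2]_msize;
  tower : 'rV[F2]_msize;
  cotower : 'cV[F2]_msize;
  diff_mx_filtered : filtered mdeg mdeg (-1) diff_mx;
  diff_mxK : diff_mx *m diff_mx = 0;
  iota_mx_filtered : filtered mdeg mdeg 0 iota_mx;
  htpy_mx_filtered : filtered mdeg mdeg 1 htpy_mx;
  iota_mx_square : filtered mdeg mdeg 2
    (iota_mx *m iota_mx + 1%:M + htpy_mx *m diff_mx + diff_mx *m htpy_mx);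
  tower_filtered : filtered (fun=> 0) mdeg 0 tower;
  tower_cycle : tower *m diff_mx = 0;
  cotower_filtered : filtered mdeg (fun=> 0) 0 cotower;
  cotower_cocycle : diff_mx *m cotower = 0;
  tower_cotower : tower *m cotower = 1
}.

Definition bdry A B (u : 'M_(msize A, msize B)) := diff_mx A *m u + u *m diff_mx B.
Definition commutator A B (u : 'M_(msize A, msize B)) := iota_mx A *m u + u *m iota_mx B.

(** The value at U = 1 of a local map. The last clause says that the tower goes
to a nontorsion class: at U = 1, being torsion means being a boundary. *)
Definition matrix_local A B (phi : 'M[F2]_(msize A, msize B)) : Prop :=
  [/\ filtered (@mdeg A) (@mdeg B) 0 phi, bdry phi = 0,
      exists2 H, filtered (@mdeg A) (@mdeg B) 1 H &
                 filtered (@mdeg A) (@mdeg B) 2 (commutator phi + bdry H)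
    & forall w, tower A *m phi != w *m diff_mx B].

Section MatrixTotal.
Variables A B : filtered_model.
Notation e := (@mdeg A).
Notation f := (@mdeg B).

Lemma bdryP a (u v : 'M_(msize A, msize B)) : bdry (a *: u + v) = a *: bdry u + bdry v.
Proof.
by rewrite /bdry linearP mulmxDl -scalemxAl scalerDr addrACA.
Qed.

Lemma commutatorP a (u v : 'M_(msize A, msize B)) :
  commutator (a *: u + v) = a *: commutator u + commutator v.
Proof.
by rewrite /commutator linearP mulmxDl -scalemxAl scalerDr addrACA.
Qed.

Lemma bdry_parity s (u : 'M_(msize A, msize B)) :
  of_parity e f s u -> of_parity e f (s - 1) (bdry u).
Proof.
move=> Pu; apply: supportedD.
  apply: of_parityM (filtered_parity (@diff_mx_filtered A)) Pu; lia.
by apply: of_parityM Pu (filtered_parity (@diff_mx_filtered B)).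
Qed.

Lemma commutator_filtered s (u : 'M_(msize A, msize B)) :
  filtered e f s u -> filtered e f s (commutator u).
Proof.
move=> Fu; apply: supportedD.
  by apply: filteredM (@iota_mx_filtered A) Fu; rewrite add0r.
by apply: filteredM Fu (@iota_mx_filtered B); rewrite addr0.
Qed.

Lemma bdryK (u : 'M_(msize A, msize B)) : bdry (bdry u) = 0.
Proof.
rewrite /bdry mulmxDr mulmxDl !mulmxA diff_mxK mul0mx add0r.
by rewrite -[u *m _ *m _]mulmxA diff_mxK mulmx0 addr0 addmF2.
Qed.

(** The degree 0 maps that are chain maps mod U. *)
Definition mod_cycle (u : 'M_(msize A, msize B)) :=
  filtered e f 0 u /\ filtered e f 1 (bdry u).

(** The subspace deciding which way the local map goes. The parity of x makes
every element of it a matrix of even degree. *)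
Definition obstruction (u : 'M_(msize A, msize B)) : Prop :=
  exists a x v, [/\ filtered e f 2 a, of_parity e f 1 x, mod_cycle v &
    u = a + bdry x + commutator v].

(** The cross terms iota v iota cancel, leaving iota^2 v + v iota^2, where each
iota^2 is replaced by 1 up to the given homotopy; the two copies of v cancel.
The terms in which v separates the homotopy from the differential are moved
into place at the cost of bdry v, which lies in degree 1. *)
Lemma commutator_commutator (v : 'M_(msize A, msize B)) : mod_cycle v ->
  filtered e f 2 (commutator (commutator v) + bdry (htpy_mx A *m v + v *m htpy_mx B)).
Proof.
move=> [Fv Fdv].
have -> : commutator (commutator v) + bdry (htpy_mx A *m v + v *m htpy_mx B) =
  (iota_mx A *m iota_mx A + 1%:M + htpy_mx A *m diff_mx A + diff_mx A *m htpy_mx A) *m v +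
  v *m (iota_mx B *m iota_mx B + 1%:M + htpy_mx B *m diff_mx B + diff_mx B *m htpy_mx B) +
  (htpy_mx A *m bdry v + bdry v *m htpy_mx B).
  rewrite /bdry /commutator !(mulmxDl, mulmxDr) mul1mx mulmx1 !mulmxA.
  (* With both sides moved to the left, each of the nine products and v occurs
     exactly twice. *)
  move: (iota_mx A *m iota_mx A *m v) (iota_mx A *m v *m iota_mx B)
    (v *m iota_mx B *m iota_mx B)
    (diff_mx A *m htpy_mx A *m v) (diff_mx A *m v *m htpy_mx B)
    (htpy_mx A *m v *m diff_mx B)
    (v *m htpy_mx B *m diff_mx B) (htpy_mx A *m diff_mx A *m v)
    (v *m diff_mx B *m htpy_mx B).
  move=> x1 x2 x3 x4 x5 x6 x7 x8 x9; apply/addmF2_eq.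
  apply/matrixP => i j; rewrite !mxE.
  transitivity ((x1 i j + x2 i j + x3 i j + x4 i j + x5 i j + x6 i j + x7 i j
    + x8 i j + x9 i j + v i j) + (x1 i j + x2 i j + x3 i j + x4 i j + x5 i j
    + x6 i j + x7 i j + x8 i j + x9 i j + v i j)); first by ring.
  exact: addF2.
apply: supportedD; first apply: supportedD.
- by apply: filteredM (@iota_mx_square A) Fv; rewrite addr0.
- by apply: filteredM Fv (@iota_mx_square B); rewrite add0r.
apply: supportedD.
- exact: filteredM (@htpy_mx_filtered A) Fdv.
- exact: filteredM Fdv (@htpy_mx_filtered B).
Qed.

(** The rank one chain map through F[U] that sends the tower of A to the tower
of B. *)
Definition tower_map : 'M_(msize A, msize B) := cotower A *m tower B.

Lemma tower_map_filtered : filtered e f 0 tower_map.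
Proof. exact: filteredM (@cotower_filtered A) (@tower_filtered B). Qed.

Lemma bdry_tower_map : bdry tower_map = 0.
Proof.
rewrite /bdry /tower_map !mulmxA cotower_cocycle mul0mx add0r.
by rewrite -mulmxA tower_cycle mulmx0.
Qed.

Lemma tower_not_bdry (C : filtered_model) w : tower C != w *m diff_mx C.
Proof.
apply/eqP => tw; have := tower_cotower C.
rewrite tw -mulmxA cotower_cocycle mulmx0 => /matrixP/(_ 0 0).
by rewrite !mxE eqxx => /eqP; rewrite eq_sym oner_eq0.
Qed.

(** The local map is a + commutator v = tower_map + bdry x: the first expression
shows that it has degree 0 and almost commutes with iota, the second that it is
a chain map with the same effect on the tower up to a boundary. *)
Lemma obstruction_local : obstruction tower_map ->
  exists phi, @matrix_local A B phi.
Proof.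
case=> a [x [v [Fa Px [Fv Fdv] eq0]]].
pose phi := a + commutator v.
have phiE : phi = tower_map + bdry x.
  by rewrite eq0; apply: addmF2_shift.
have Fc := commutator_filtered Fv.
exists phi; split.
- by apply: supportedD Fc; apply: (@filtered_lower 0).
- by rewrite phiE -[tower_map]scale1r bdryP bdry_tower_map bdryK scaler0 addr0.
- exists (htpy_mx A *m v + v *m htpy_mx B).
    apply: supportedD.
      by apply: filteredM (@htpy_mx_filtered A) Fv.
    by apply: filteredM Fv (@htpy_mx_filtered B).
  rewrite /phi -[a]scale1r commutatorP scale1r -addrA; apply: supportedD.
    exact: commutator_filtered.
  exact: commutator_commutator.
move=> w; apply/negP => /eqP tw.
have /negP[] := tower_not_bdry (w + tower A *m x).
rewrite mulmxDl -tw phiE mulmxDr mulmxA tower_cotower mul1mx /bdry.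
by rewrite mulmxDr mulmxA tower_cycle mul0mx add0r !mulmxA -addrA addmF2 addr0.
Qed.

End MatrixTotal.

(** * Duality and the dichotomy *)

Lemma filtered_dual m n (e : 'I_m -> int) (f : 'I_n -> int) (y : 'M[F2]_(n, m)) :
    of_parity f e 0 y -> (forall u, filtered e f 2 u -> \tr (y *m u) = 0) ->
  filtered f e 0 y.
Proof.
move=> Py yF j i yij; have := Py _ _ yij; have := supported_pairing yF yij.
by rewrite /parity_entry /graded_entry; lia.
Qed.

Section Duality.
Variables A B : filtered_model.
Notation e := (@mdeg A).
Notation f := (@mdeg B).

(** The differentials of Hom(A, B) and Hom(B, A) are adjoint for the trace
pairing. *)
Lemma bdry_dual (S : 'I_(msize A) -> 'I_(msize B) -> bool)
    (y : 'M[F2]_(msize B, msize A)) :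
    (forall u, supported S u -> \tr (y *m bdry u) = 0) ->
  supported (fun j i => ~~ S i j) (bdry y).
Proof.
move=> yS; apply: supported_pairing => u Su.
by rewrite -mxtrace_adjoint yS.
Qed.

End Duality.

Section Total.
Variables A B : filtered_model.
Notation e := (@mdeg A).
Notation f := (@mdeg B).

Definition null_mod (u : 'M[F2]_(msize A, msize B)) : Prop :=
  exists a h, [/\ filtered e f 2 a, filtered e f 1 h & u = a + bdry h].

Lemma null_mod0 : null_mod 0.
Proof.
exists 0, 0; split; try exact: supported0.
by rewrite /bdry mulmx0 mul0mx !addr0.
Qed.

Lemma null_modP a u v : null_mod u -> null_mod v -> null_mod (a *: u + v).
Proof.
move=> [b [h [Fb Fh ->]]] [b' [h' [Fb' Fh' ->]]].
exists (a *: b + b'), (a *: h + h'); split; try exact: supportedP.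
by rewrite bdryP scalerDr addrACA.
Qed.

Lemma obstruction0 : @obstruction A B 0.
Proof.
have b0 : @bdry A B 0 = 0 by rewrite /bdry mulmx0 mul0mx addr0.
exists 0, 0, 0; split; rewrite /mod_cycle ?b0; try split; try exact: supported0.
by rewrite /commutator mulmx0 mul0mx !addr0.
Qed.

Lemma obstructionP a u v : @obstruction A B u -> @obstruction A B v ->
  @obstruction A B (a *: u + v).
Proof.
move=> [b [x [w [Fb Px [Fw Fdw] ->]]]] [b' [x' [w' [Fb' Px' [Fw' Fdw'] ->]]]].
exists (a *: b + b'), (a *: x + x'), (a *: w + w').
split; try exact: supportedP.
  by split; rewrite ?bdryP; apply: supportedP.
by rewrite bdryP commutatorP !scalerDr addrACA [a *: b + _ + _]addrACA.
Qed.

End Total.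

(** A matrix of even degree orthogonal to all null-homotopic ones mod U is a
chain map mod U, so y, being orthogonal to chain maps mod U, cannot be separated
from the null-homotopic ones. *)
Lemma null_mod_dual (A B : filtered_model) (y : 'M[F2]_(msize B, msize A)) :
    of_parity (@mdeg B) (@mdeg A) 0 y ->
    (forall v : 'M_(msize A, msize B), mod_cycle v -> \tr (y *m v) = 0) ->
  null_mod y.
Proof.
move=> Py yv; apply: contrapT => nQ.
have [v [Pv Qv]] :=
  supported_trace_separation (@null_mod0 B A) (@null_modP B A) Py nQ.
rewrite mxtrace_mulC yv => [/eqP|]; first by rewrite eq_sym oner_eq0.
have {}Pv : of_parity (@mdeg A) (@mdeg B) 0 v.
  by apply: supported_sub Pv => i j; rewrite /parity_entry; lia.
have Qb h : filtered (@mdeg B) (@mdeg A) 1 h -> \tr (v *m bdry h) = 0.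
  move=> Fh; apply: Qv.
    by exists 0, h; split; rewrite ?add0r //; apply: supported0.
  exact: (@bdry_parity _ _ 1) (filtered_parity Fh).
split.
  apply: filtered_dual => // a Fa; apply: Qv.
    exists a, 0; split; rewrite // ?/bdry ?mulmx0 ?mul0mx ?addr0 //.
    exact: supported0.
  by move/filtered_parity: Fa; apply: supported_sub => i j; rewrite /parity_entry; lia.
move=> i j vij; have := bdry_dual Qb vij.
by have := bdry_parity Pv vij; rewrite /parity_entry /graded_entry; lia.
Qed.

(** Each of the three families spanning the obstruction subspace contributes one
property of the separating matrix, and its value on the tower map contributes
the fourth. *)
Lemma unobstructed_local (A B : filtered_model) :
  ~ obstruction (tower_map A B) -> exists psi, @matrix_local B A psi.
Proof.
move=> nQ.
have Pt := filtered_parity (@tower_map_filtered A B).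
have [y [Py Qy yt]] :=
  supported_trace_separation (@obstruction0 A B) (@obstructionP A B) Pt nQ.
have {}Py : of_parity (@mdeg B) (@mdeg A) 0 y.
  by apply: supported_sub Py => i j; rewrite /parity_entry; lia.
have b0 : @bdry A B 0 = 0 by rewrite /bdry mulmx0 mul0mx addr0.
have c0 : @commutator A B 0 = 0 by rewrite /commutator mulmx0 mul0mx addr0.
have s0 S : supported S (0 : 'M[F2]_(msize A, msize B)) := @supported0 _ _ _ S.
have Fy : filtered (@mdeg B) (@mdeg A) 0 y.
  apply: filtered_dual => // a Fa; apply: Qy.
    exists a, 0, 0; split; rewrite // /mod_cycle ?b0 ?c0 ?addr0 //.
  by move/filtered_parity: Fa; apply: supported_sub => i j; rewrite /parity_entry; lia.
have y_cycle : bdry y = 0.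
  apply/matrixP => j i; rewrite [RHS]mxE; apply/eqP/negPn/negP => yji.
  have Qb x : of_parity (@mdeg A) (@mdeg B) 1 x -> \tr (y *m bdry x) = 0.
    move=> Px; apply: Qy; last exact: (@bdry_parity _ _ 1).
    exists 0, x, 0; split; rewrite // /mod_cycle ?b0 ?c0 ?addr0 ?add0r //.
  have := bdry_dual Qb yji; have := bdry_parity Py yji.
  by rewrite /parity_entry; lia.
exists y; split=> //.
  have [||a [h [Fa Fh eqh]]] := @null_mod_dual A B (commutator y).
  - exact/filtered_parity/commutator_filtered.
  - move=> v Zv; rewrite -mxtrace_adjoint; apply: Qy.
      by exists 0, 0, v; split; rewrite ?b0 ?add0r.
    by apply/filtered_parity/commutator_filtered; case: Zv.
  by exists h => //; rewrite eqh -addrA addmF2 addr0.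
move=> w; apply/negP => /eqP tw; move: yt.
rewrite /tower_map mulmxA mxtrace_mulC mulmxA tw -mulmxA cotower_cocycle mulmx0.
by rewrite mxtrace0 => /eqP; rewrite eq_sym oner_eq0.
Qed.

Theorem matrix_local_total (A B : filtered_model) :
  (exists phi, @matrix_local A B phi) \/ (exists psi, @matrix_local B A psi).
Proof.
have [ob|nob] := pselect (obstruction (tower_map A B)).
  by left; apply: obstruction_local.
by right; apply: unobstructed_local.
Qed.

(** * Homogeneous matrices over F[U] and their value at U = 1 *)

Notation at1 := (map_mx (horner_eval (1 : F2))).

Definition homogeneous m n (e : 'I_m -> int) (f : 'I_n -> int) (s : int)
    (M : 'M[FU]_(m, n)) : Prop :=
  forall i j k, (M i j)`_k != 0 -> f j = e i + s + (k.*2)%:Z.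

Lemma homogP r (deg : 'I_r -> int) k x :
  homog deg k x <-> homogeneous (fun=> k) deg 0 x.
Proof.
split=> hx i j => [l|]; last by move=> /hx; lia.
by rewrite [i]ord1 => /hx; lia.
Qed.

Lemma F2_nonzero (c : F2) : c != 0 -> c = 1.
Proof. by case: c => [[|[|//]]] // ? _; apply: val_inj. Qed.

(** Over F the only nonzero homogeneous polynomials are the powers of U. *)
Lemma F2_monomial (p : FU) :
  (forall j k, p`_j != 0 -> p`_k != 0 -> j = k) -> p != 0 -> exists k, p = 'X^k.
Proof.
move=> pP p0; have lc : p`_(size p).-1 != 0.
  by rewrite -lead_coefE lead_coef_eq0.
exists (size p).-1; apply/polyP => k; rewrite coefXn.
have [->|nk] := eqVneq k; first exact: F2_nonzero.
by apply/eqP/negPn/negP => /pP/(_ lc) ek; rewrite ek eqxx in nk.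
Qed.

Lemma homogeneous_monomial m n (e : 'I_m -> int) (f : 'I_n -> int) s M i j :
    homogeneous e f s M -> M i j != 0 ->
  exists2 k, M i j = 'X^k & f j = e i + s + (k.*2)%:Z.
Proof.
move=> hM Mij; have [|k Mk] := F2_monomial _ Mij.
  by move=> k l /hM ek /hM; lia.
by exists k => //; apply: hM; rewrite Mk coefXn eqxx oner_eq0.
Qed.

(** A homogeneous matrix has monomial entries, and monomials do not vanish at
U = 1. *)
Lemma at1_inj m n (e : 'I_m -> int) (f : 'I_n -> int) s M :
  homogeneous e f s M -> at1 M = 0 -> M = 0.
Proof.
move=> hM M1; apply/matrixP => i j; rewrite [RHS]mxE.
apply/eqP/negPn/negP => /(homogeneous_monomial hM)[k Mij _].
have /matrixP/(_ i j) := M1.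
by rewrite !mxE Mij /horner_eval hornerXn expr1n => /eqP; rewrite oner_eq0.
Qed.

Lemma at1_filtered m n (e : 'I_m -> int) (f : 'I_n -> int) s M :
  homogeneous e f s M -> filtered e f s (at1 M).
Proof.
move=> hM i j; rewrite mxE; have [->|] := eqVneq (M i j) 0.
  by rewrite /horner_eval horner0 eqxx.
by move=> /(homogeneous_monomial hM)[k _ ek] _; rewrite /graded_entry ek; lia.
Qed.

(** The grading dictates which power of U each entry must carry. *)
Lemma homogeneous_lift m n (e : 'I_m -> int) (f : 'I_n -> int) s N :
  filtered e f s N -> exists2 M, homogeneous e f s M & at1 M = N.
Proof.
move=> hN; exists (\matrix_(i, j) (N i j *: 'X^(absz (f j - e i - s)%R %/ 2))).
  move=> i j k; rewrite mxE coefZ coefXn mulf_eq0 negb_or => /andP[/hN].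
  by rewrite /graded_entry; case: (k =P _) => [->|_]; rewrite ?eqxx //; lia.
by apply/matrixP => i j; rewrite !mxE /horner_eval hornerZ hornerXn expr1n mulr1.
Qed.

Lemma homogeneousM r s t m n p (e : 'I_m -> int) (f : 'I_n -> int)
    (g : 'I_p -> int) (M : 'M_(m, n)) (N : 'M_(n, p)) :
    r = s + t -> homogeneous e f s M -> homogeneous f g t N ->
  homogeneous e g r (M *m N).
Proof.
move=> -> hM hN i k l; rewrite mxE => c.
have [j] : exists j, (M i j * N j k)`_l != 0.
  apply/existsP; apply: contraNT c => /existsPn h.
  rewrite coef_sum big1 // => j _; exact/eqP/negbNE/h.
have [->|Mij] := eqVneq (M i j) 0; first by rewrite mul0r coef0 eqxx.
have [->|Njk] := eqVneq (N j k) 0; first by rewrite mulr0 coef0 eqxx.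
have [a -> ea] := homogeneous_monomial hM Mij.
have [b -> eb] := homogeneous_monomial hN Njk.
by rewrite -exprD coefXn; case: (l =P _) => [->|]; rewrite ?eqxx //; lia.
Qed.

Lemma homogeneousD m n (e : 'I_m -> int) (f : 'I_n -> int) s M N :
  homogeneous e f s M -> homogeneous e f s N -> homogeneous e f s (M + N).
Proof.
move=> hM hN i j k; rewrite mxE coefD.
by have [->|/hM//] := eqVneq (M i j)`_k 0; rewrite add0r => /hN.
Qed.

Lemma homogeneousXn r s l m n (e : 'I_m -> int) (f : 'I_n -> int) M :
    r = s - (l.*2)%:Z ->
  homogeneous e f s M -> homogeneous e f r ('X^l *: M).
Proof.
move=> -> hM i j k; rewrite mxE coefXnM.
by case: ltnP => [|lk /hM ->]; rewrite ?eqxx //; lia.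
Qed.

Lemma at1_Xn l m n (M : 'M_(m, n)) : at1 ('X^l *: M) = at1 M.
Proof.
by apply/matrixP => i j; rewrite !mxE /horner_eval hornerM hornerXn expr1n mul1r.
Qed.

Lemma at1_eq m n (e : 'I_m -> int) (f : 'I_n -> int) s M N :
  homogeneous e f s M -> homogeneous e f s N -> at1 M = at1 N -> M = N.
Proof.
move=> hM hN eMN; apply/eqP; rewrite -subr_eq0; apply/eqP.
apply: (@at1_inj _ _ e f s); last by rewrite map_mxB eMN subrr.
apply: homogeneousD => // i j k; rewrite mxE coefN oppr_eq0; exact: hN.
Qed.

Lemma filtered_imU m n (e : 'I_m -> int) (f : 'I_n -> int) s M :
  homogeneous e f s M -> filtered e f (s + 2) (at1 M) -> exists N, M = 'X *: N.
Proof.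
move=> hM /homogeneous_lift[N hN NM]; exists N.
have hXN : homogeneous e f s ('X^1 *: N) by apply: homogeneousXn hN; lia.
by apply: at1_eq hM hXN _; rewrite at1_Xn.
Qed.

Lemma imU_filtered m n (e : 'I_m -> int) (f : 'I_n -> int) s M :
    homogeneous e f s M -> in_imU (mulmxr M : 'rV_m -> 'rV_n) ->
  filtered e f (s + 2) (at1 M).
Proof.
move=> hM MU i j; rewrite mxE; have [->|Mij] := eqVneq (M i j) 0.
  by rewrite /horner_eval horner0 eqxx.
have [k Mk ek] := homogeneous_monomial hM Mij => _.
have [y] := MU (delta_mx 0 i); rewrite /= -rowE => /rowP/(_ j).
rewrite !mxE Mk => /polyP/(_ 0%N); rewrite coefXn coefXM /=.
by case: k {Mk} ek => //= k ek _; rewrite /graded_entry ek; lia.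
Qed.

Lemma has_degreeP (C D : complex) s (g : {linear carrier C -> carrier D}) :
  has_degree s g <-> homogeneous (@deg C) (@deg D) s (lin1_mx g).
Proof.
split=> [gs i j k|hg k x /homogP hx].
  rewrite mxE => gij.
  have hi : homog (@deg C) (deg i) (delta_mx 0 i).
    move=> l p; rewrite mxE eqxx /=; case: (l =P i) => [->|_]; last by rewrite coef0 eqxx.
    by rewrite coef1; case: p => //=; lia.
  by have := gs _ _ hi _ _ gij; lia.
apply/homogP; rewrite -mul_rV_lin1.
have := homogeneousM (add0r _) hx hg.
by move=> h i j l /h; lia.
Qed.

Lemma has_degree_mulmx (C D : complex) s (M : 'M_(rank C, rank D)) :
  homogeneous (@deg C) (@deg D) s M -> has_degree s (mulmxr M : carrier C -> carrier D).
Proof.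
move=> hM k x /homogP hx; apply/homogP.
by move=> i j l /(homogeneousM (esym (add0r _)) hx hM); lia.
Qed.

(** * Specializing an almost iota-complex at U = 1 *)

Lemma restrict_mulmx (F : finFieldType) m n p (R : 'I_m -> 'I_p -> bool)
    (S : 'I_m -> 'I_n -> bool) (T : 'I_n -> 'I_p -> bool)
    (M : 'M[F]_(m, n)) (N : 'M[F]_(n, p)) :
    (forall i j k, T j k -> R i k = S i j) -> supported T N ->
  restrict R (M *m N) = restrict S M *m N.
Proof.
move=> RST TN; apply/matrixP => i k; rewrite !mxE.
case: ifP => Rik; last apply: esym.
  apply: eq_bigr => j _; rewrite mxE.
  have [->|/TN/RST <-] := eqVneq (N j k) 0; first by rewrite !mulr0.
  by rewrite Rik.
rewrite big1 // => j _; rewrite mxE.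
have [->|/TN/RST <-] := eqVneq (N j k) 0; first by rewrite mulr0.
by rewrite Rik mul0r.
Qed.

(** Lowering the degree by a large even number removes the sign constraint;
this corresponds to multiplying by a power of U. *)
Lemma of_parity_filtered m n (e : 'I_m -> int) (f : 'I_n -> int) s M :
  of_parity e f s M -> exists l : nat, filtered e f (s - (l.*2)%:Z) M.
Proof.
move=> PM; pose b i j := absz (f j - e i - s)%R.
exists (\sum_i \sum_j b i j)%N => i j /PM.
have : (b i j <= \sum_i \sum_j b i j)%N.
  by rewrite (bigD1 i) //= (bigD1 j) //= -addnA leq_addr.
by rewrite /parity_entry /graded_entry /b; lia.
Qed.

Section Complex.
Variable C : complex.
Notation dm := (lin1_mx (diff C)).
Notation g := (@deg C).

Lemma diff_homogeneous : homogeneous g g (-1) dm.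
Proof. by apply/(@has_degreeP C C); apply: diff_homog. Qed.

Lemma diff_linK : dm *m dm = 0.
Proof.
apply/row_matrixP => i; rewrite row_mul row0 rowE !mul_rV_lin1 /=.
exact: diffK.
Qed.

(** A primitive w at U = 1 may be taken of the parity opposite to that of z; then
it lifts to a homogeneous primitive of U^l z for large l. *)
Lemma nontorsionP (z : cycle C) k : homog g k (val z) ->
  nontorsion (hclass z) <-> forall w, at1 (val z) != w *m at1 dm.
Proof.
move=> /homogP hz; split=> [nz w|nz n].
  apply/negP => /eqP ew.
  have Pz := filtered_parity (at1_filtered hz).
  have Pd := filtered_parity (at1_filtered diff_homogeneous).
  (* The differential exchanges parities, so the component of w of parity
     k + 1 already has boundary at1 (val z). *)
  pose w' := restrict (parity_entry (fun=> k) g 1) w.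
  have ew' : at1 (val z) = w' *m at1 dm.
    rewrite -(restrict_id Pz) ew; apply: (restrict_mulmx _ _ Pd) => i j l.
    by rewrite /parity_entry; lia.
  have Pw : of_parity (fun=> k) g 1 w' := @restrict_supported _ _ _ _ w.
  have [l Fw] := of_parity_filtered Pw.
  have [Y hY Yw] := homogeneous_lift Fw.
  apply: (nz l); rewrite /hclass -qclassZ -[RHS](linear0 (qclass (@is_boundary C))).
  apply/qclass_eq; rewrite subr0; apply/asboolP; exists Y.
  rewrite linearZ /= -mul_rV_lin1.
  have hYd : homogeneous (fun=> k) g (- (l.*2)%:Z) (Y *m dm).
    apply: homogeneousM hY diff_homogeneous; lia.
  have hzn : homogeneous (fun=> k) g (- (l.*2)%:Z) ('X^l *: val z).
    by apply: homogeneousXn hz; lia.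
  by apply: (at1_eq hYd hzn); rewrite at1_Xn map_mxM Yw ew'.
rewrite /hclass -qclassZ -[RHS](linear0 (qclass (@is_boundary C))).
move=> /qclass_eq; rewrite subr0 => /asboolP[y].
rewrite linearZ /= -mul_rV_lin1 => /(congr1 at1).
rewrite map_mxM at1_Xn => ey; have := nz (at1 y).
by rewrite ey eqxx.
Qed.

Lemma is_cycleP x : (x \in @is_cycle C) <-> x *m dm = 0.
Proof. by rewrite unfold_in mul_rV_lin1; split=> /eqP. Qed.

End Complex.

Section Specialization.
Variable A : almost_iota.
Notation dm := (lin1_mx (diff A)).
Notation im := (lin1_mx (ai_iota A)).
Notation g := (@deg A).

Lemma iota_homogeneous : homogeneous g g 0 im.
Proof. by apply/(@has_degreeP A A); apply: ai_iota_degree. Qed.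

Lemma iota_square_htpy : exists H : 'M[F2]_(rank A), filtered g g 1 H /\
  filtered g g 2 (at1 im *m at1 im + 1%:M + H *m at1 dm + at1 dm *m H).
Proof.
have [H [/(@has_degreeP A A) hH HU]] := ai_iota_square A.
exists (at1 (lin1_mx H)); split; first exact: at1_filtered.
pose M := im *m im + 1%:M + lin1_mx H *m dm + dm *m lin1_mx H.
have hM : homogeneous g g 0 M.
  have hd := @diff_homogeneous A; have hi := iota_homogeneous.
  apply: homogeneousD; first apply: homogeneousD; first apply: homogeneousD.
  - exact: (homogeneousM _ hi hi).
  - move=> i j k; rewrite mxE; case: (i =P j) => [->|]; rewrite ?coef0 ?eqxx //.
    by rewrite coef1; case: k => //=; lia.
  - exact: homogeneousM hH hd.
  - exact: homogeneousM hd hH.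
have -> : at1 im *m at1 im + 1%:M + at1 (lin1_mx H) *m at1 dm +
    at1 dm *m at1 (lin1_mx H) = at1 M.
  by rewrite /M !map_mxD !map_mxM map_mx1.
apply: (imU_filtered hM) => x; have [y Hy] := HU x; exists y; rewrite -Hy.
rewrite /= /M !mulmxDr mulmx1 !mulmxA !mul_rV_lin1 /=.
by rewrite -!addrA [diff A _ + _]addrC.
Qed.

Lemma tower_cycle_exists : exists z : cycle A, homog g 0 (val z) /\ nontorsion (hclass z).
Proof.
by have [[h [[z [hz ->]] nz]] _] := ai_normalized A; exists z.
Qed.

Definition tower_cyc : cycle A := sval (cid tower_cycle_exists).

Lemma tower_cyc_homog : homog g 0 (val tower_cyc).
Proof. by rewrite /tower_cyc; case: cid => z []. Qed.

Lemma tower_cyc_nontorsion : nontorsion (hclass tower_cyc).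
Proof. by rewrite /tower_cyc; case: cid => z []. Qed.

Lemma tower_cyc_cycle : val tower_cyc *m dm = 0.
Proof. by apply/is_cycleP; case: tower_cyc. Qed.

Lemma tower_cyc_filtered : filtered (fun=> 0) g 0 (at1 (val tower_cyc)).
Proof. by apply: at1_filtered; apply/homogP/tower_cyc_homog. Qed.

(** The vectors on which a degree 0 cocycle to F[U] has to vanish at U = 1:
boundaries, and vectors of degree 2, which have no image in F[U] of the same
degree. *)
Definition killed_mod (u : 'rV[F2]_(rank A)) : Prop :=
  exists a w, [/\ filtered (fun=> 0) g 2 a, of_parity (fun=> 0) g 1 w &
    u = a + w *m at1 dm].

(** Otherwise the tower would be homologous at U = 1 to a cycle of degree 2, which
would then be nontorsion, against the normalization of gradings. *)
Lemma tower_not_killed : ~ killed_mod (at1 (val tower_cyc)).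
Proof.
move=> [a [w [Fa _ et]]].
have [Z hZ Za] := homogeneous_lift Fa.
have hd := @diff_homogeneous A.
have ad : a *m at1 dm = 0.
  have := tower_cyc_cycle => /(congr1 at1); rewrite map_mxM et mulmxDl.
  by rewrite -mulmxA -map_mxM diff_linK map_mx0 mulmx0 addr0 map_mx0.
have cZ : Z \in @is_cycle A.
  apply/is_cycleP; apply: at1_inj (homogeneousM (erefl _) hZ hd) _.
  by rewrite map_mxM Za.
have hZ2 : homog g 2 Z by apply/homogP => i j k /hZ; lia.
have nZ : nontorsion (hclass (Cycle cZ)).
  apply/(nontorsionP (z := Cycle cZ) hZ2) => w' /=; rewrite Za.
  have /(nontorsionP tower_cyc_homog)/(_ (w' + w)) := tower_cyc_nontorsion.
  by apply: contra => /eqP aw'; rewrite et aw' mulmxDl.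
have [_ le0] := ai_normalized A.
by have := le0 2 _ (ex_intro _ (Cycle cZ) (conj hZ2 erefl)) nZ.
Qed.

Lemma cotower_exists : exists c : 'cV[F2]_(rank A),
  [/\ filtered g (fun=> 0) 0 c, at1 dm *m c = 0 & at1 (val tower_cyc) *m c = 1].
Proof.
have Q0 : killed_mod 0.
  by exists 0, 0; split; rewrite ?mul0mx ?addr0 //; apply: supported0.
have Qlin a u v : killed_mod u -> killed_mod v -> killed_mod (a *: u + v).
  move=> [b [h [Fb Fh ->]]] [b' [h' [Fb' Fh' ->]]].
  exists (a *: b + b'), (a *: h + h'); split; try exact: supportedP.
  by rewrite mulmxDl -scalemxAl scalerDr addrACA.
have Pt := filtered_parity tower_cyc_filtered.
have [c [Pc Qc ct]] := supported_trace_separation Q0 Qlin Pt tower_not_killed.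
have {}Pc : of_parity g (fun=> 0) 0 c.
  by apply: supported_sub Pc => i j; rewrite /parity_entry; lia.
have Pd := filtered_parity (at1_filtered (@diff_homogeneous A)).
exists c; split.
- apply: filtered_dual => // a Fa; apply: Qc.
    by exists a, 0; rewrite mul0mx addr0; split=> //; apply: supported0.
  by move/filtered_parity: Fa; apply: supported_sub => i j; rewrite /parity_entry; lia.
- apply/matrixP => i j; rewrite [RHS]mxE; apply/eqP/negPn/negP => nz.
  have Qd w : of_parity (fun=> 0) g 1 w -> \tr (at1 dm *m c *m w) = 0.
    move=> Pw; rewrite -mulmxA mxtrace_mulC -mulmxA; apply: Qc.
      by exists 0, w; rewrite add0r; split=> //; apply: supported0.
    exact: of_parityM Pw Pd.
  have := supported_pairing Qd nz; have := of_parityM (erefl _) Pd Pc nz.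
  by rewrite /parity_entry; lia.
- by rewrite [LHS]mx11_scalar -trace_mx11 mxtrace_mulC ct.
Qed.

Definition specialization : filtered_model :=
  let H := svalP (cid iota_square_htpy) in
  let c := svalP (cid cotower_exists) in
  @FilteredModel (rank A) g (at1 dm) (at1 im) _ (at1 (val tower_cyc)) _
    (at1_filtered (@diff_homogeneous A))
    (etrans (esym (map_mxM _ _ _)) (etrans (congr1 at1 (diff_linK A)) (map_mx0 _ _ _)))
    (at1_filtered iota_homogeneous) H.1 H.2
    tower_cyc_filtered
    (etrans (esym (map_mxM _ _ _)) (etrans (congr1 at1 tower_cyc_cycle) (map_mx0 _ _ _)))
    (and3_rec (fun a _ _ => a) c) (and3_rec (fun _ b _ => b) c)
    (and3_rec (fun _ _ d => d) c).

End Specialization.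

(** * Localized homology *)

Lemma loc_scale_frac (M : lmodType FU) (a : FU) (x : M) m :
  a *: frac x m = frac (a *: x) m.
Proof. exact: loc_scaleE. Qed.

Lemma frac_eq0 (M : lmodType FU) (x : M) m :
  frac x m = 0 <-> exists k, 'X^k *: x = 0.
Proof.
split=> [/frac_eq[k]|[k xk]]; first by rewrite addn0 scaler0; exists k.
by apply/frac_eq; exists k; rewrite addn0 xk scaler0.
Qed.

Lemma loc_scaleX_eq0 (M : lmodType FU) k (w : loc M) : 'X^k *: w = 0 -> w = 0.
Proof.
rewrite -[w]fracK loc_scale_frac => /frac_eq0[l].
by rewrite scalerA -exprD => xl; apply/frac_eq0; exists (l + k)%N.
Qed.

(** Over F[U, U^-1] this says that u is a basis of the localized module. *)
Definition generates (M : lmodType FU) (u : loc M) : Prop :=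
  (forall q : FU, q *: u = 0 -> q = 0) /\
  (forall w, exists k (q : FU), 'X^k *: w = q *: u).

Lemma laurent_generates j n : generates (frac ('X^j : FU^o) n).
Proof.
split=> [q|w].
  rewrite loc_scale_frac => /frac_eq0[k] /eqP.
  rewrite /GRing.scale /= !mulf_eq0 !expf_eq0 !polyX_eq0 !andbF !orbF orFb.
  by move/eqP.
exists (denom w + j)%N, ('X^n * numer w).
rewrite -{2}[w]fracK !loc_scale_frac; apply/frac_eq; exists 0%N.
have shift (p : FU) l : 'X^(0 + n) * ('X^(l + j) * p) = 'X^(0 + l) * ('X^n * p * 'X^j).
  by rewrite !add0n exprD -!mulrA [p * _]mulrC [RHS]mulrCA; congr (_ * _); rewrite mulrCA.
exact: shift.
Qed.

(** A nonzero homogeneous Laurent polynomial is a power of U, hence a unit. *)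
Lemma homog_laurent_generates k (v : Laurent) :
  loc_homog poly_homog k v -> v != 0 -> generates v.
Proof.
move=> [p [n [hp ->]]] pn0.
have p0 : (p : FU) != 0.
  by apply: contraNneq pn0 => p0; apply/eqP/frac_eq0; exists 0%N; rewrite p0 scaler0.
have [|j ->] := F2_monomial _ p0; last exact: laurent_generates.
by move=> i j /hp ei /hp; lia.
Qed.

Lemma generates_bij (M N : lmodType FU) (F : {linear loc M -> loc N}) u :
  generates u -> generates (F u) -> bijective F.
Proof.
move=> [_ gu] [fu gFu].
have Finj w : F w = 0 -> w = 0.
  move=> Fw; have [k [q e]] := gu w.
  have FuZ : q *: F u = 0 by move: (linearZ_LR F q u); rewrite -e linearZ_LR Fw scaler0.
  by apply: (@loc_scaleX_eq0 _ k); rewrite e (fu q FuZ) scale0r.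
have Fsurj v : exists w, F w = v.
  have [k [q e]] := gFu v.
  (* This fraction is q *: u divided by 'X^k. *)
  exists (frac (numer (q *: u)) (k + denom (q *: u))).
  apply/eqP; rewrite -subr_eq0; apply/eqP; apply: (@loc_scaleX_eq0 _ k).
  by rewrite scalerBr e -!linearZ_LR loc_scale_frac fracX fracK subrr.
have Fsurjb v : exists w, F w == v by have [w <-] := Fsurj v; exists w.
exists (fun v => xchoose (Fsurjb v)) => [w|v]; last exact/eqP/(xchooseP (Fsurjb v)).
apply/eqP; rewrite -subr_eq0; apply/eqP/Finj; rewrite linearB /=.
by have /eqP -> := xchooseP (Fsurjb (F w)); rewrite subrr.
Qed.

(** A homogeneous isomorphism with the Laurent polynomials sends the nonzero
fraction of z to a unit. *)
Lemma nontorsion_generates (A : almost_iota) (z : cycle A) :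
    homog (@deg A) 0 (val z) -> nontorsion (hclass z) ->
  generates (frac (hclass z) 0).
Proof.
move=> hz nz; have [phi [s [[psi phiK psiK] hphi]]] := ai_loc A.
have phi0 w : phi w = 0 -> w = 0 by move=> e; rewrite -[w]phiK e -[RHS]phiK linear0.
set u := frac _ _.
have hu : loc_homog (@homology_homog A) 0 u.
  by exists (hclass z), 0%N; split=> //; exists z.
have u0 : u != 0 by apply/eqP => /frac_eq0[k]; exact: nz.
have pu0 : phi u != 0 by apply: contraNneq u0 => /phi0 ->.
have [g1 g2] := homog_laurent_generates (hphi _ _ hu) pu0.
split=> [q qu|w]; first by apply: g1; rewrite -linearZ qu linear0.
have [k [q e]] := g2 (phi w); exists k, q.
by apply: (can_inj phiK); rewrite !linearZ.
Qed.

Lemma hclassZ (C : complex) (a : FU) (z : cycle C) : a *: hclass z = hclass (a *: z).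
Proof. by rewrite /hclass qclassZ. Qed.

Lemma hclassD (C : complex) (y z : cycle C) : hclass y + hclass z = hclass (y + z).
Proof. by rewrite /hclass qclassD. Qed.

Lemma loc_homology_map_linear (C D : complex) (f : chain_map C D) :
  linear (loc_homology_map f).
Proof.
have fracP w : exists z n, w = frac (@hclass C z) n.
  by exists (qrepr (numer w)), (denom w); rewrite /hclass qreprK fracK.
move=> a u v; have [x [m ->]] := fracP u; have [y [n ->]] := fracP v.
rewrite !loc_homology_mapE !loc_scale_frac !hclassZ.
rewrite [in LHS]/+%R /= loc_addE [RHS]loc_addE !hclassZ !hclassD.
rewrite loc_homology_mapE; congr (frac (hclass _) _).
by apply: val_inj; rewrite /= linearD 3![f (_ *: _)]linearZ.
Qed.

(** Evaluation at U = 1 is injective on homogeneous maps of a fixed degree, so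
the homogeneous lifts of the matrix and of its homotopy satisfy the identities
that hold at U = 1. *)
Lemma local_of_matrix (A B : almost_iota) (phi : 'M[F2]_(rank A, rank B)) :
  @matrix_local (specialization A) (specialization B) phi -> local_le A B.
Proof.
move=> [/= Fphi dphi [H FH HU] nt].
have [M hM Mphi] := homogeneous_lift Fphi.
have [N hN NH] := homogeneous_lift FH.
have hdA := @diff_homogeneous A; have hdB := @diff_homogeneous B.
have hiA := @iota_homogeneous A; have hiB := @iota_homogeneous B.
have MD : lin1_mx (diff A) *m M = M *m lin1_mx (diff B).
  apply: (@at1_eq _ _ (@deg A) (@deg B) (-1)).
  - exact: homogeneousM hdA hM.
  - exact: homogeneousM hM hdB.
  - by rewrite !map_mxM Mphi; apply/addmF2_eq.
pose fl : {linear carrier A -> carrier B} := mulmxr M.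
have fdeg : has_degree 0 fl := has_degree_mulmx hM.
have fcomm x : fl (diff A x) = diff B (fl x).
  by rewrite /= -!mul_rV_lin1 -!mulmxA MD.
pose f := ChainMap fdeg fcomm.
exists f; split.
  exists (mulmxr N : {linear carrier A -> carrier B}).
  split; first exact: has_degree_mulmx.
  pose G := lin1_mx (ai_iota A) *m M + M *m lin1_mx (ai_iota B) +
    (lin1_mx (diff A) *m N + N *m lin1_mx (diff B)).
  have hG : homogeneous (@deg A) (@deg B) 0 G.
    apply: homogeneousD; apply: homogeneousD.
    - exact: homogeneousM hiA hM.
    - exact: homogeneousM hM hiB.
    - exact: homogeneousM hdA hN.
    - exact: homogeneousM hN hdB.
  have [|K GK] := filtered_imU hG.
    by rewrite add0r !map_mxD !map_mxM Mphi NH.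
  move=> x; exists (x *m K); rewrite scalemxAr -GK /G !mulmxDr !mulmxA.
  by rewrite !mul_rV_lin1 /= !addrA.
pose z := tower_cyc A.
have hz := @tower_cyc_homog A.
have hfz : homog (@deg B) 0 (val (cycle_map f z)).
  by have := fdeg _ _ hz; rewrite addr0.
pose F : {linear loc (homology A) -> loc (homology B)} :=
  HB.pack (loc_homology_map f)
    (GRing.isLinear.Build _ _ _ _ _ (loc_homology_map_linear f)).
apply: (@generates_bij _ _ F (frac (hclass z) 0)).
  exact: nontorsion_generates hz (@tower_cyc_nontorsion A).
rewrite /F /= loc_homology_mapE; apply: nontorsion_generates => //.
apply/(nontorsionP hfz) => w; rewrite /= map_mxM Mphi; exact: nt.
Qed.

Theorem theorem3p25 : forall X Y : Ihat, (X <= Y)%O \/ (Y <= X)%O.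
Proof.
move=> X Y; rewrite -[X]local_reprK -[Y]local_reprK !le_local_class.
have [[phi Lphi]|[psi Lpsi]] := matrix_local_total
  (specialization (local_repr X)) (specialization (local_repr Y)).
  by left; apply: local_of_matrix Lphi.
by right; apply: local_of_matrix Lpsi.
Qed.
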